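(* If $H$ is a real Hilbert space, then $H$ has the BPBp-nu for compact operators.
   Context: For a Banach space $X$, $S_X$ is its unit sphere, $X^*$ its dual, $\mathcal{K}(X)$ the space of compact linear operators from $X$ to $X$, and $\Pi(X)=\{(x,x^* )\in S_X\times S_{X^*}: x^*(x)=1\}$. The numerical radius of a bounded linear operator $T$ on $X$ is $\nu(T)=\sup\{|x^*(T(x))|:(x,x^* )\in\Pi(X)\}$. A Banach space $X$ has the Bishop-Phelps-Bollobás property for numerical radius for compact operators (BPBp-nu for compact operators) if for every $0<\varepsilon<1$ there exists $\eta(\varepsilon)\in(0,1)$ such that whenever $T\in\mathcal{K}(X)$ and $(x,x^* )\in\Pi(X)$ satisfy $\nu(T)=1$ and $|x^*(T(x))|>1-\eta(\varepsilon)$, there exist $S\in\mathcal{K}(X)$ and $(y,y^* )\in\Pi(X)$ such that $\nu(S)=|y^*(S(y))|=1$, $\|T-S\|<\varepsilon$, $\|x-y\|<\varepsilon$ and $\|x^*-y^*\|<\varepsilon$. *)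

(* Defs.v *)
From HB Require Import structures.
From mathcomp Require Import all_boot all_order all_algebra.
From mathcomp Require Import boolp classical_sets functions reals.
From mathcomp Require Import topology normedtype.

Set Implicit Arguments.
Unset Strict Implicit.
Unset Printing Implicit Defensive.

Import Order.TTheory GRing.Theory Num.Theory.
Import numFieldNormedType.Exports.

Local Open Scope classical_set_scope.
Local Open Scope ring_scope.

Definition unit_ball {R : realType} (X : normedModType R) : set X :=
  [set x | `|x| <= 1].
Arguments unit_ball {R} X.

(* [sup] returns 0 on a set that is not bounded above, so [opnorm T] is the
   operator norm only for bounded [T]. With [W := R^o] it is the norm of the
   dual space. *)
Definition opnorm {R : realType} (V W : normedModType R) (T : V -> W) : R :=
  sup [set `|T x| | x in unit_ball V].

Definition compact_operator {R : realType} (X : normedModType R)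
    (T : {linear X -> X}) : Prop :=
  precompact (T @` unit_ball X).

Definition sphere {R : realType} (X : normedModType R) : set X :=
  [set x | `|x| = 1].
Arguments sphere {R} X.

Definition dual_sphere {R : realType} (X : normedModType R) :
    set {linear X -> R^o} :=
  [set f : {linear X -> R^o} | continuous f /\ opnorm f = 1].
Arguments dual_sphere {R} X.

Definition state_pairs {R : realType} (X : normedModType R) :
    set (X * {linear X -> R^o}) :=
  [set p | [/\ sphere X p.1, dual_sphere X p.2 & p.2 p.1 = 1]].
Arguments state_pairs {R} X.

(* Same proviso as for [opnorm]: a genuine supremum for bounded [T] on a
   nonzero space; on the zero space there are no state pairs and the value
   is 0. *)
Definition numerical_radius {R : realType} (X : normedModType R)
    (T : {linear X -> X}) : R :=
  sup [set `|p.2 (T p.1)| | p in state_pairs X].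

Definition BPBp_nu_compact {R : realType} (X : completeNormedModType R) : Prop :=
  forall eps : R, 0 < eps < 1 ->
  exists2 eta : R, 0 < eta < 1 &
  forall (T : {linear X -> X}) (x : X) (xs : {linear X -> R^o}),
    compact_operator T -> state_pairs X (x, xs) ->
    numerical_radius T = 1 -> 1 - eta < `|xs (T x)| ->
  exists (S : {linear X -> X}) (y : X) (ys : {linear X -> R^o}),
    [/\ compact_operator S, state_pairs X (y, ys),
        numerical_radius S = 1 & `|ys (S y)| = 1]
    /\ [/\ opnorm (T \- S) < eps, `|x - y| < eps & opnorm (xs \- ys) < eps].

(* Main.v *)
Require Import Defs.
From HB Require Import structures.
From mathcomp Require Import all_boot all_order all_algebra.
From mathcomp Require Import boolp classical_sets functions reals.
From mathcomp Require Import topology normedtype.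
From mathcomp Require Import ring lra.

Import Order.TTheory GRing.Theory Num.Theory.
Import numFieldNormedType.Exports.
Local Open Scope ring_scope.

(** The pair [(x, xs)] itself works. In a Hilbert space [xs] is [<., x>]. Put
    [a = <T x, x>] and let [sg] be the sign of [a]. As the quadratic form
    [<T u, u>] is bounded by [|u|^2] and nearly attains this bound at [x], the
    cross term [b z = <T x, z> + <T z, x>] is small on the orthogonal of [x].
    Adding to [T] the rank-one operator [s x + z |-> ((sg - a) s - b z) x]
    turns the quadratic form into [sg s^2 + <T z, z>], whose supremum on the
    sphere is 1 and is attained at [x]. *)

(** [S] maps the unit ball into the image of the compact product of the closure of [T(B)] with
    [[-M, M]] under the continuous map [(v, c) |-> v + c x]. *)
Lemma compact_operator_rank1_perturbation (R : realType) (X : normedModType R)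
    (T S : {linear X -> X}) (phi : X -> R) (x : X) (M : R) :
  (forall u, `|u| <= 1 -> `|phi u| <= M) ->
  (forall u, S u = T u + phi u *: x) ->
  compact_operator T -> compact_operator S.
Proof.
move=> phiM SE; rewrite /compact_operator precompactE => Tc.
pose f (p : X * R) := p.1 + p.2 *: x.
have fc : continuous f.
  move=> p; apply: cvgD; first exact: cvg_fst.
  by apply: cvgZr_tmp; exact: cvg_snd.
have Kc := compact_setX Tc (@segment_compact R (- M) M).
have fKc := continuous_compact (continuous_subspaceT fc) Kc.
apply: precompact_subset (compact_precompact (@norm_hausdorff _ _) fKc).
move=> _ [u /= u1 <-]; exists (T u, phi u); last by rewrite /f SE.
split => /=; first by apply: subset_closure; exists u.
by rewrite in_itv /= -ler_norml; exact: phiM.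
Qed.

Lemma opnorm_le (R : realType) (V W : normedModType R) (f : V -> W) (M : R) :
  (forall u, `|u| <= 1 -> `|f u| <= M) -> opnorm f <= M.
Proof.
move=> fM; apply: ge_sup; last by move=> _ [u u1 <-]; exact: fM.
by exists `|f 0|, 0 => //; rewrite /unit_ball /= normr0.
Qed.

Lemma opnorm1_bound (R : realType) (X : normedModType R)
    (f : {linear X -> R^o}) (u : X) :
  opnorm f = 1 -> `|f u| <= `|u|.
Proof.
move=> f1.
(* The value 1 differs from the default 0 of [sup], so this supremum is genuine. *)
have fub : has_sup [set `|f v| | v in unit_ball X]%classic.
  by apply: contrapT => /sup_out; rewrite -/(opnorm f) f1 => /eqP; rewrite oner_eq0.
have [->|u0] := eqVneq u 0; first by rewrite linear0 !normr0.
have nu : 0 < `|u| by rewrite normr_gt0.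
have : `|f (`|u|^-1 *: u)| <= opnorm f.
  apply: sup_upper_bound => //; exists (`|u|^-1 *: u) => //.
  by rewrite /unit_ball /= normrZ normfV normr_id mulVf ?gt_eqF.
by rewrite f1 linearZ /= normrZ normfV normr_id ler_pdivrMl // mulr1.
Qed.

Section RealHilbert.
Context {R : realType} {H : completeNormedModType R}.
Variable dot : {dot H for idfun}.
Hypothesis normE : forall x : H, `|x| = Num.sqrt (dot x x).

Lemma dotC u v : dot u v = dot v u.
Proof. by rewrite (hermC (theta := idfun)) expr0 mul1r. Qed.

Lemma dotDl u v w : dot (u + v) w = dot u w + dot v w.
Proof. exact: linearDl. Qed.

Lemma dotZl c u v : dot (c *: u) v = c * dot u v.
Proof. exact: linearZl_LR. Qed.

Lemma dot0l u : dot 0 u = 0.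
Proof. by rewrite -(scale0r u) dotZl mul0r. Qed.

Lemma dotDr u v w : dot w (u + v) = dot w u + dot w v.
Proof. by rewrite dotC dotDl !(dotC w). Qed.

Lemma dotZr c u v : dot v (c *: u) = c * dot v u.
Proof. by rewrite dotC dotZl (dotC v). Qed.

Lemma dot_ge0 u : 0 <= dot u u.
Proof.
have [->|u0] := eqVneq u 0; last by rewrite ltW // neq0_dnorm_gt0.
by rewrite dot0l.
Qed.

Lemma dot_sqr_norm u : dot u u = `|u| ^+ 2.
Proof. by rewrite normE sqr_sqrtr // dot_ge0. Qed.

Lemma dot_sphere x : sphere H x -> dot x x = 1.
Proof. by rewrite /sphere /= dot_sqr_norm => ->; rewrite expr1n. Qed.

Lemma norm_dot_sphere_le x u : sphere H x -> `|dot u x| <= `|u|.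
Proof.
move=> /dot_sphere x1; rewrite -ler_sqr ?nnegrE // real_normK ?num_real //.
(* Cauchy-Schwarz: the squared norm of [u - <u, x> x] is [|u|^2 - <u, x>^2]. *)
rewrite -dot_sqr_norm; have := dot_ge0 (u + (- dot u x) *: x).
rewrite !dotDl !dotDr !dotZl !dotZr x1 (dotC x u); lra.
Qed.

Lemma state_pair_of_dot x :
  sphere H x -> exists xs : {linear H -> R^o}, state_pairs H (x, xs).
Proof.
move=> x1.
have dlin : linear (fun u => dot u x : R^o).
  by move=> c u v; rewrite dotDl dotZl.
pose Lx := GRing.isLinear.Build R H R^o *:%R _ dlin.
pose xs : {linear H -> R^o} := HB.pack (fun u : H => dot u x : R^o) Lx.
exists xs; split => //; last exact: dot_sphere.
split.
  apply: bounded_linear_continuous; apply/linear_boundedP.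
  near=> r => u; apply: (le_trans (norm_dot_sphere_le x u x1)).
  by rewrite ler_peMl //; near: r; exact: nbhs_pinfty_ge.
apply/eqP; rewrite eq_le; apply/andP; split.
  by apply: opnorm_le => u; apply: le_trans; exact: norm_dot_sphere_le.
apply: ub_le_sup.
  by exists 1 => _ [u u1 <-]; apply: le_trans u1; exact: norm_dot_sphere_le.
exists x; first by rewrite /unit_ball /= x1.
by rewrite /= dot_sphere // normr1.
Unshelve. all: by end_near. Qed.

(** A functional of norm 1 that attains its norm at [x] vanishes on the orthogonal of [x]: for such
    [z], [(1 + t xs z)^2] is at most [|x + t z|^2 = 1 + t^2 |z|^2] for every [t], which forces the
    linear term in [t] to vanish. *)
Lemma state_pair_dot x (xs : {linear H -> R^o}) u :
  state_pairs H (x, xs) -> xs u = dot u x.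
Proof.
move=> [/= x1 [_ xs1] xsx]; have xx := dot_sphere x x1.
pose z := u + (- dot u x) *: x.
have zx : dot z x = 0 by rewrite dotDl dotZl xx mulr1 subrr.
suff : xs z = 0.
  rewrite linearD linearZ /= xsx => /eqP.
  by rewrite /GRing.scale /= mulr1 subr_eq0 => /eqP.
clearbody z; have xsz_le (t : R) : (1 + t * xs z) ^+ 2 <= 1 + t ^+ 2 * dot z z.
  have := opnorm1_bound _ _ xs (x + t *: z) xs1.
  rewrite -ler_sqr ?nnegrE // real_normK ?num_real // -dot_sqr_norm.
  rewrite linearD linearZ /= xsx !dotDl !dotDr !dotZl !dotZr xx (dotC x z) zx.
  by rewrite /GRing.scale /=; lra.
have zz := dot_ge0 z.
(* The bound at [t] gives [2 t (xs z) <= t^2 |z|^2]; take [t] proportional to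
   [xs z]. *)
have d0 : 0 < 1 + dot z z by lra.
have := xsz_le (xs z / (1 + dot z z)).
set k := (1 + dot z z)^-1; have k0 : 0 < k by rewrite invr_gt0.
have kE : k * dot z z = 1 - k.
  by rewrite /k; field; lra.
move=> h; apply/eqP; rewrite -sqrf_eq0; apply/eqP/le_anti; rewrite sqr_ge0 andbT.
have h2 : k * xs z ^+ 2 * (2 + k * xs z ^+ 2) <= k * xs z ^+ 2 * (k * dot z z).
  by move: h; rewrite /GRing.scale /=; lra.
have h3 := mulr_ge0 (ltW k0) (sqr_ge0 (xs z)).
(* With [s = xs z] the bound reads [k s^2 (1 + k + k s^2) <= 0], so [s = 0]. *)
rewrite kE in h2; rewrite -(pmulr_rle0 _ k0); nra.
Qed.

(** Both sides are homogeneous of degree 2, and each unit vector [v] enters the supremum through the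
    state pair [(v, <., v>)]. As the radius is 1, it is not the default value of [sup]. *)
Lemma numerical_radius1_quad_le (T : {linear H -> H}) u :
  numerical_radius T = 1 -> `|dot (T u) u| <= dot u u.
Proof.
move=> T1.
have Tub : has_sup [set `|p.2 (T p.1)| | p in state_pairs H]%classic.
  apply: contrapT => /sup_out; rewrite -/(numerical_radius T) T1 => /eqP.
  by rewrite oner_eq0.
have [->|u0] := eqVneq u 0; first by rewrite (linear0 T) dot0l normr0.
have nu : 0 < `|u| by rewrite normr_gt0.
pose v := `|u|^-1 *: u.
have v1 : sphere H v by rewrite /sphere /= normrZ normfV normr_id mulVf ?gt_eqF.
have [vs vvs] := state_pair_of_dot v v1.
have : `|vs (T v)| <= numerical_radius T.
  by apply: sup_upper_bound => //; exists (v, vs).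
rewrite T1 (state_pair_dot _ _ _ vvs) /v (linearZZ T) /= dotZl dotZr mulrA normrM.
rewrite -expr2 ger0_norm ?sqr_ge0 // exprVn ler_pdivrMl ?exprn_gt0 //.
by rewrite mulr1 dot_sqr_norm.
Qed.

Lemma numerical_radius_attained (S : {linear H -> H}) x (xs : {linear H -> R^o}) :
  (forall u, `|dot (S u) u| <= dot u u) -> state_pairs H (x, xs) ->
  `|dot (S x) x| = 1 -> numerical_radius S = 1.
Proof.
move=> Sle xxs Sx; apply/eqP; rewrite eq_le; apply/andP.
have Sub : ubound [set `|p.2 (S p.1)| | p in state_pairs H]%classic 1.
  move=> _ [[y ys] yys <-] /=; rewrite (state_pair_dot _ _ _ yys).
  by rewrite (le_trans (Sle _)) // dot_sphere //; case: yys.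
have Sin : [set `|p.2 (S p.1)| | p in state_pairs H]%classic 1.
  by exists (x, xs) => //=; rewrite (state_pair_dot _ _ _ xxs).
split; first by apply: ge_sup => //; exists 1.
by apply: ub_le_sup => //; exists 1.
Qed.

(** For [u = s x + z] with [z] orthogonal to the unit vector [x], this is
    [(sg - a) s - b z] in the notation of the header. *)
Definition rank1_coef (T : H -> H) (x : H) (sg : R) (u : H) : R :=
  (sg + dot (T x) x) * dot u x - (dot (T x) u + dot (T u) x).

Definition rank1_correction (T : {linear H -> H}) (x : H) (sg : R) (u : H) : H :=
  T u + rank1_coef T x sg u *: x.

Lemma rank1_correction_linear (T : {linear H -> H}) x sg :
  linear (rank1_correction T x sg).
Proof.
move=> c u v; rewrite /rank1_correction /rank1_coef (linearD T) (linearZZ T)/=.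
rewrite !dotDl !dotDr !dotZl !dotZr scalerDr [RHS]addrACA; congr (_ + _).
by rewrite scalerA -scalerDl; congr (_ *: _); ring.
Qed.

Section Correction.
Variables (T : {linear H -> H}) (x : H) (sg : R).
Hypotheses (xx : dot x x = 1) (sg2 : sg ^+ 2 = 1).
Hypothesis Tle : forall u, `|dot (T u) u| <= dot u u.

Lemma quad_rank1_correction u (z := u + (- dot u x) *: x) :
  dot (rank1_correction T x sg u) u = sg * dot u x ^+ 2 + dot (T z) z.
Proof.
rewrite /z /rank1_correction /rank1_coef (linearD T) (linearZZ T) /=.
rewrite !dotDl !dotDr !dotZl !dotZr (dotC x u); ring.
Qed.

Lemma dot_split u (z := u + (- dot u x) *: x) :
  dot u u = dot u x ^+ 2 + dot z z.
Proof.
rewrite /z !dotDl !dotDr !dotZl !dotZr (dotC x u) xx; ring.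
Qed.

Lemma norm_sg : `|sg| = 1.
Proof.
by apply/eqP; rewrite -(@eqrXn2 _ 2) // expr1n -normrX sg2 normr1.
Qed.

(** With the cross terms gone, the two remaining terms are bounded by the two summands of
    Pythagoras. *)
Lemma quad_rank1_correction_le u :
  `|dot (rank1_correction T x sg u) u| <= dot u u.
Proof.
rewrite quad_rank1_correction dot_split; apply: (le_trans (ler_normD _ _)).
by rewrite normrM norm_sg mul1r normrX real_normK ?num_real // lerD2l Tle.
Qed.

(** The coefficient is [(sg - a) s - b z]; the first term contributes at most [t] and the second at
    most [3 t]. *)
Lemma rank1_coef_le t u : 0 < t <= 1 -> 1 - t ^+ 2 < sg * dot (T x) x ->
  dot u u <= 1 -> `|rank1_coef T x sg u| <= 4 * t.
Proof.
move=> /andP[t0 t1] ta u1.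
pose z := u + (- dot u x) *: x; pose b := dot (T x) z + dot (T z) x.
have zx : dot x z = 0 by rewrite dotDr dotZr xx (dotC x u); lra.
have zz : 0 <= dot z z <= 1.
  by rewrite dot_ge0 /=; move: u1 (sqr_ge0 (dot u x)); rewrite dot_split -/z; lra.
have sgle v : `|sg * dot (T v) v| <= dot v v by rewrite normrM norm_sg mul1r.
(* Test the quadratic bound at [x + r z]: one [t^2] comes from the defect [1 - sg a], the other two
   from [r^2 |z|^2] and [- r^2 sg <T z, z>]. Taking [r = t] and [r = - t] then bounds [|b|]. *)
have ble r : r ^+ 2 = t ^+ 2 -> r * (sg * b) <= 3 * t ^+ 2.
  move=> rt; have /ler_normlP[_ h1] := sgle (x + r *: z).
  have /ler_normlP[h2 _] := sgle z.
  move: h1; rewrite (linearD T) (linearZZ T) /= !dotDl !dotDr !dotZl !dotZr.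
  rewrite (dotC z x) zx xx => h1.
  have h3 : r ^+ 2 * (- (sg * dot (T z) z)) <= r ^+ 2 * dot z z.
    by rewrite ler_wpM2l ?sqr_ge0.
  have h4 : t ^+ 2 * dot z z <= t ^+ 2 by rewrite ler_piMr ?sqr_ge0; lra.
  rewrite rt in h3; rewrite /b; move: h1 h3 h4; rewrite -rt; lra.
have bt : `|b| <= 3 * t.
  have -> : `|b| = `|sg * b| by rewrite normrM norm_sg mul1r.
  apply/ler_normlP.
  have h1 := ble t erefl; have h2 := ble (- t) (sqrrN t).
  by split; rewrite -(ler_pM2l t0); lra.
(* Multiplying by [sg] turns this into [1 - sg a], which is below [t^2 <= t]. *)
have at2 : `|sg - dot (T x) x| <= t.
  rewrite -[leLHS]mul1r -[X in X * _]norm_sg -normrM mulrBr -expr2 sg2.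
  have /ler_normlP[_] := sgle x; rewrite xx => h1.
  by rewrite ger0_norm; nra.
have s1 : `|dot u x| <= 1.
  rewrite -(@ler_pXn2r _ 2) ?nnegrE // expr1n real_normK ?num_real //.
  by move: u1; rewrite dot_split -/z; lra.
(* The subtracted sum contains [2 a s], which turns [sg + a] into [sg - a]. *)
have -> : rank1_coef T x sg u = (sg - dot (T x) x) * dot u x - b.
  rewrite /rank1_coef /b /z (linearD T) (linearZZ T) /= !dotDr !dotDl !dotZl !dotZr; ring.
rewrite (le_trans (ler_normB _ _)) // normrM.
have := ler_pM (normr_ge0 _) (normr_ge0 _) at2 s1; lra.
Qed.

End Correction.

End RealHilbert.

Theorem corollary1p14 (R : realType) (H : completeNormedModType R)
  (dot : {dot H for idfun})
  (normE : forall x : H, `|x| = Num.sqrt (dot x x)) :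
  BPBp_nu_compact H.
Proof.
(* The correction has norm at most [4 t = eps / 2], and [t ^+ 2] is the defect that [rank1_coef_le]
   allows. *)
move=> eps /andP[eps0 eps1]; pose t := eps / 8.
have t0 : 0 < t <= 1 by apply/andP; split; rewrite /t; lra.
exists (t ^+ 2); first by apply/andP; split; rewrite /t; nra.
move=> T x xs Tc xxs T1; rewrite (state_pair_dot dot normE _ _ _ xxs) => Tx.
have x1 : sphere H x by case: xxs.
have xx := dot_sphere dot normE _ x1.
have Tle u := numerical_radius1_quad_le dot normE T u T1.
pose sg := Num.sg (dot (T x) x).
have sgT : sg * dot (T x) x = `|dot (T x) x| by rewrite normrEsg.
(* The sign is not 0, since [|a| > 1 - t^2 > 0]. *)
have sg2 : sg ^+ 2 = 1.
  rewrite sqr_sg; case: eqVneq Tx => // ->.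
  by rewrite normr0 /t; nra.
rewrite -sgT in Tx.
pose LS := GRing.isLinear.Build R H H *:%R _ (rank1_correction_linear dot T x sg).
pose S : {linear H -> H} := HB.pack (rank1_correction dot T x sg) LS.
have coef_le u : `|u| <= 1 -> `|rank1_coef dot T x sg u| <= 4 * t.
  move=> u1; apply: rank1_coef_le => //.
  by rewrite (dot_sqr_norm dot normE) expr_le1.
(* At [x] the orthogonal component is 0, so the form equals [sg]. *)
have Sx : `|dot (S x) x| = 1.
  rewrite quad_rank1_correction // xx scaleN1r subrr (linear0 T) (dot0l dot).
  by rewrite addr0 expr1n mulr1 norm_sg.
exists S, x, xs; split; split => //.
- exact: compact_operator_rank1_perturbation coef_le _ Tc.
- apply: (numerical_radius_attained dot normE) xxs Sx => u.
  exact: quad_rank1_correction_le.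
- by rewrite (state_pair_dot dot normE _ _ _ xxs).
- apply: (@le_lt_trans _ _ (4 * t)); last by rewrite /t; lra.
  apply: opnorm_le => u u1 /=.
  by rewrite /rank1_correction opprD addNKr normrN normrZ x1 mulr1 coef_le.
- by rewrite subrr normr0.
- apply: (@le_lt_trans _ _ 0) => //.
  by apply: opnorm_le => u _ /=; rewrite subrr normr0.
Qed.
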